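(* Let $(Q,C)$ be a truncated quiver which has enough compatibles and is sufficiently cyclic. (a) The set $\{C'\subset Q_1\mid C'\sim C\}$ is transitive under successive cut-mutations. (b) The set of all slices in $\mathbb{Z}(Q,C)$ is transitive under successive slice-mutations.
   Context: A truncated quiver is a pair $(Q,C)$ of a quiver $Q$ (vertices $Q_0$, arrows $Q_1$) and a subset $C\subset Q_1$. A walk in $Q$ is a path in the quiver obtained by adding a formal inverse $a^{-1}$ in the opposite direction for each $a\in Q_1$. Let $g_C(a)=1$ for $a\in C$, $g_C(a)=0$ for $a\in Q_1\setminus C$, $g_C(a^{-1})=-g_C(a)$, extended additively to walks. Subsets $C,C'\subset Q_1$ are compatible, written $C\sim C'$, if $g_C(p)=g_{C'}(p)$ for every cyclic walk $p$ in $Q$. $(Q,C)$ has enough compatibles if $Q_1=\bigcup_{C'\sim C}C'$. $(Q,C)$ is sufficiently cyclic if for each $a\in Q_1$ there is a cycle (oriented cyclic path) $p$ in $Q$ containing $a$ with $g_C(p)\le1$. Cut-mutation: a vertex $x$ is a strict source of $(Q,C)$ if all arrows ending at $x$ belong to $C$ and all arrows starting at $x$ do not belong to $C$; then $\mu^+_x(C)$ is obtained from $C$ by removing all arrows of $Q$ ending at $x$ and adding all arrows of $Q$ starting at $x$. Dually, $x$ is a strict sink if all arrows starting at $x$ belong to $C$ and no arrow ending at $x$ belongs to $C$; then $\mu^-_x(C)$ is obtained by removing all arrows starting at $x$ and adding all arrows ending at $x$. These operations are called cut-mutations. The quiver $\mathbb{Z}(Q,C)$ has vertex set $Q_0\times\mathbb{Z}$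 and, for $\ell\in\mathbb{Z}$, arrows $(a,\ell):(x,\ell)\to(y,\ell)$ for $a:x\to y$ in $Q_1\setminus C$ and $(a,\ell):(x,\ell)\to(y,\ell-1)$ for $a:x\to y$ in $C$; $\tau$ is the automorphism increasing $\ell$ by $1$. A slice is a full subquiver $S$ of $\mathbb{Z}(Q,C)$, with vertex set denoted $S_0$, such that any $\tau$-orbit of vertices contains precisely one vertex of $S$, and for any arrow $x\to y$ in $\mathbb{Z}(Q,C)$ with $x\in S_0$ we have $y\in S_0\cup\tau^{-1}S_0$. Slice-mutation: a vertex $x$ of a slice $S$ is a strict source if all arrows of $\mathbb{Z}(Q,C)$ ending at $x$ do not belong to $S$ and all arrows of $\mathbb{Z}(Q,C)$ starting at $x$ belong to $S$; then $\mu^+_x(S)$ is the full subquiver with vertex set $(S_0\setminus\{x\})\cup\{\tau^{-1}x\}$. Dually, $x$ is a strict sink if all arrows ending at $x$ belong to $S$ and no arrow starting at $x$ does; then $\mu^-_x(S)$ is the full subquiver with vertex set $(S_0\setminus\{x\})\cup\{\tau x\}$. These operations are called slice-mutations. A set is transitive under successive mutations if any two of its elements are connected by a finite sequence of such mutations.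
   Formalization: The quiver Q is assumed finite and without loops: with a loop, or with infinitely many vertices, part (b) is false (e.g. one vertex with one loop a and C={a}: no slice can be mutated). *)

(* Defs.v *)
From HB Require Import structures.
From Stdlib Require Import Relation_Operators.
From mathcomp Require Import all_boot all_order all_algebra.
From mathcomp Require Import boolp classical_sets.

Set Implicit Arguments.
Unset Strict Implicit.
Unset Printing Implicit Defensive.

Import Order.TTheory GRing.Theory Num.Theory.
Local Open Scope ring_scope.
Local Open Scope classical_set_scope.

Record quiver (V A : Type) := Quiver { qsrc : A -> V ; qtgt : A -> V }.

(* The empty sequence is the trivial path at [x], also when walks are considered. *)
Fixpoint is_path V A (Q : quiver V A) (x : V) (p : seq A) (y : V) : Prop :=
  if p is a :: p' then qsrc Q a = x /\ is_path Q (qtgt Q a) p' y else x = y.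

(* A loop at x prevents every mutation at x, since it both starts and ends there. *)
Definition no_loops V A (Q : quiver V A) : Prop :=
  forall a, qsrc Q a <> qtgt Q a.

(* [inl a] stands for the arrow a and [inr a] for its formal inverse. *)
Definition double V A (Q : quiver V A) : quiver V (A + A) :=
  Quiver (fun w => match w with inl a => qsrc Q a | inr a => qtgt Q a end)
         (fun w => match w with inl a => qtgt Q a | inr a => qsrc Q a end).

Definition is_walk V A (Q : quiver V A) (x : V) (p : seq (A + A)) (y : V) :=
  is_path (double Q) x p y.

Definition grade A (C : set A) (a : A) : int := if a \in C then 1 else 0.

Definition path_grade A (C : set A) (p : seq A) : int :=
  \sum_(a <- p) grade C a.

Definition walk_grade A (C : set A) (p : seq (A + A)) : int :=
  \sum_(w <- p) match w with inl a => grade C a | inr a => - grade C a end.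

Definition compatible V A (Q : quiver V A) (C C' : set A) : Prop :=
  forall x p, is_walk Q x p x -> walk_grade C p = walk_grade C' p.

Definition enough_compatibles V A (Q : quiver V A) (C : set A) : Prop :=
  [set: A] = \bigcup_(C' in [set C' | compatible Q C' C]) C'.

Definition sufficiently_cyclic V (A : eqType) (Q : quiver V A) (C : set A) :
    Prop :=
  forall a : A, exists x p,
    [/\ is_path Q x p x, a \in p & path_grade C p <= 1].

Definition cut_strict_source V A (Q : quiver V A) (C : set A) (x : V) : Prop :=
  (forall a, qtgt Q a = x -> C a) /\ (forall a, qsrc Q a = x -> ~ C a).

Definition cut_strict_sink V A (Q : quiver V A) (C : set A) (x : V) : Prop :=
  (forall a, qsrc Q a = x -> C a) /\ (forall a, qtgt Q a = x -> ~ C a).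

Definition cut_mu_plus V A (Q : quiver V A) (x : V) (C : set A) : set A :=
  (C `\` [set a | qtgt Q a = x]) `|` [set a | qsrc Q a = x].

Definition cut_mu_minus V A (Q : quiver V A) (x : V) (C : set A) : set A :=
  (C `\` [set a | qsrc Q a = x]) `|` [set a | qtgt Q a = x].

Definition cut_mutation V A (Q : quiver V A) (C C' : set A) : Prop :=
  exists x, (cut_strict_source Q C x /\ C' = cut_mu_plus Q x C) \/
            (cut_strict_sink Q C x /\ C' = cut_mu_minus Q x C).

Definition Zquiver V A (Q : quiver V A) (C : set A) :
    quiver (V * int) (A * int) :=
  Quiver (fun b => (qsrc Q b.1, b.2))
         (fun b => (qtgt Q b.1, if b.1 \in C then b.2 - 1 else b.2)).

(* The power tau^k, on vertices. *)
Definition tau_pow V (k : int) (v : V * int) : V * int := (v.1, v.2 + k).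

Definition tau_orbit V (v : V * int) : set (V * int) :=
  [set w | exists k : int, w = tau_pow k v].

(* A full subquiver is represented by its set of vertices S; these are the
   arrows which belong to it. *)
Definition full_arrows V A (Q : quiver V A) (S : set V) : set A :=
  [set a | S (qsrc Q a) /\ S (qtgt Q a)].

Definition is_slice V A (Q : quiver V A) (C : set A) (S : set (V * int)) :
    Prop :=
  (forall v, exists! w, tau_orbit v w /\ S w) /\
  (forall b, S (qsrc (Zquiver Q C) b) ->
     (S `|` tau_pow (-1) @` S) (qtgt (Zquiver Q C) b)).

Definition slice_strict_source V A (Q : quiver V A) (C : set A)
    (S : set (V * int)) (v : V * int) : Prop :=
  [/\ S v,
      forall b, qtgt (Zquiver Q C) b = v -> ~ full_arrows (Zquiver Q C) S b &
      forall b, qsrc (Zquiver Q C) b = v -> full_arrows (Zquiver Q C) S b].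

Definition slice_strict_sink V A (Q : quiver V A) (C : set A)
    (S : set (V * int)) (v : V * int) : Prop :=
  [/\ S v,
      forall b, qtgt (Zquiver Q C) b = v -> full_arrows (Zquiver Q C) S b &
      forall b, qsrc (Zquiver Q C) b = v -> ~ full_arrows (Zquiver Q C) S b].

Definition slice_mu_plus V (v : V * int) (S : set (V * int)) : set (V * int) :=
  (S `\` [set v]) `|` [set tau_pow (-1) v].

Definition slice_mu_minus V (v : V * int) (S : set (V * int)) :
    set (V * int) :=
  (S `\` [set v]) `|` [set tau_pow 1 v].

Definition slice_mutation V A (Q : quiver V A) (C : set A)
    (S S' : set (V * int)) : Prop :=
  exists v, (slice_strict_source Q C S v /\ S' = slice_mu_plus v S) \/
            (slice_strict_sink Q C S v /\ S' = slice_mu_minus v S).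

(* All the intermediate elements of the sequence are required to be in X. *)
Definition transitive_under T (X : set T) (mut : T -> T -> Prop) : Prop :=
  forall s t, X s -> X t ->
    clos_refl_trans T (fun u v => [/\ X u, X v & mut u v]) s t.

(* Main.v *)
Require Import Defs.
From Stdlib Require Import Relation_Operators.
From mathcomp Require Import all_boot all_order all_algebra.
From mathcomp Require Import zify.
From mathcomp Require Import boolp classical_sets.

Set Implicit Arguments.
Unset Strict Implicit.
Unset Printing Implicit Defensive.

Import Order.TTheory GRing.Theory Num.Theory.
Local Open Scope ring_scope.
Local Open Scope classical_set_scope.

(** Both parts are statements about integer functions on the vertices. Write
    g for the grade of C. A slice contains exactly one vertex (x, f x) over
    each vertex x of Q, and the condition on arrows says that, for every arrow
    a : x -> y, the slope g(a) + f y - f x is 0 or 1. Call such an f a height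
    ([is_height]). The arrows of slope 1 form a set D compatible with C,
    because on a cyclic walk the increments of f cancel; conversely, if D is
    compatible with C then the difference of the two grades vanishes on cyclic
    walks and hence comes from a potential f
    ([compatible_is_height_cut]). In both pictures a mutation at a strict
    source x is the same operation on heights: lower f by 1 at x; a mutation
    at a strict sink undoes it ([cut_mutation_lower],
    [slice_mutation_lower]). So it suffices to connect any two heights by
    lowerings at strict sources and their inverses.

    The pointwise minimum of two heights is a height, so it suffices to go down
    from a height h to a height k <= h, and for this to find, when h <> k, a
    strict source of the cut D of h at which h > k. Let X be the set of
    vertices where h - k attains its maximum. An arrow crossing the boundary of
    X has different slopes for h and k, which forces an arrow entering X to
    be in D and an arrow leaving X to be outside D. Inside X, order the
    vertices by existence of a nonempty path of D-grade 0 and take a minimal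
    one ([exists_strict_source]). An arrow outside D is such a path, and an
    arrow of D can be completed to a cycle of grade 1, which gives such a path
    in the opposite direction, so a minimal vertex of X is a strict source. The
    order is irreflexive because a cycle of D-grade 0 would have grade 0 for
    every compatible set, although each of its arrows lies in one of them. *)

(** * Paths, walks and their grades *)

Lemma is_path_cat V A (Q : quiver V A) (p q : seq A) (x z : V) :
  is_path Q x (p ++ q) z <-> exists2 y, is_path Q x p y & is_path Q y q z.
Proof.
elim: p x => [|a p IH] x /=.
  by split=> [qP|[y -> //]]; exists x.
split=> [[ax /IH[y pP qP]]|[y [ax pP] qP]]; first by exists y.
by split=> //; apply/IH; exists y.
Qed.

Lemma is_walk_cat V A (Q : quiver V A) (p q : seq (A + A)) (x y z : V) :
  is_walk Q x p y -> is_walk Q y q z -> is_walk Q x (p ++ q) z.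
Proof. by move=> pP qP; apply/is_path_cat; exists y. Qed.

Definition flip A (w : A + A) : A + A :=
  match w with inl a => inr a | inr a => inl a end.

Lemma is_walk_inv V A (Q : quiver V A) (p : seq (A + A)) (x y : V) :
  is_walk Q x p y -> is_walk Q y (rev (map (@flip A) p)) x.
Proof.
elim: p x => [|w p IH] x /=; first by move=> ->.
move=> [wx pP]; rewrite rev_cons -cats1; apply/is_path_cat.
exists (qtgt (Defs.double Q) w); first exact: IH.
by case: w {pP} wx => a /= <-.
Qed.

Lemma walk_grade_cons A (C : set A) (w : A + A) (p : seq (A + A)) :
  walk_grade C (w :: p) =
  match w with inl a => grade C a | inr a => - grade C a end + walk_grade C p.
Proof. by rewrite /walk_grade big_cons. Qed.

Lemma walk_grade_cat A (C : set A) (p q : seq (A + A)) :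
  walk_grade C (p ++ q) = walk_grade C p + walk_grade C q.
Proof. by rewrite /walk_grade big_cat. Qed.

Lemma walk_grade_inv A (C : set A) (p : seq (A + A)) :
  walk_grade C (rev (map (@flip A) p)) = - walk_grade C p.
Proof.
elim: p => [|w p IH]; first by rewrite /walk_grade !big_nil oppr0.
rewrite map_cons rev_cons -cats1 walk_grade_cat IH !walk_grade_cons.
by rewrite /walk_grade big_nil; case: w => a /=; lia.
Qed.

Lemma is_path_walk V A (Q : quiver V A) (p : seq A) (x y : V) :
  is_path Q x p y -> is_walk Q x (map inl p) y.
Proof. by elim: p x => [|a p IH] x //= [ax /IH]. Qed.

Lemma path_walk_grade A (C : set A) (p : seq A) :
  walk_grade C (map inl p) = path_grade C p.
Proof. by rewrite /walk_grade big_map. Qed.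

Lemma path_grade_cons A (C : set A) (a : A) (p : seq A) :
  path_grade C (a :: p) = grade C a + path_grade C p.
Proof. by rewrite /path_grade big_cons. Qed.

Lemma path_grade_cat A (C : set A) (p q : seq A) :
  path_grade C (p ++ q) = path_grade C p + path_grade C q.
Proof. by rewrite /path_grade big_cat. Qed.

Lemma grade_in A (C : set A) (a : A) : C a -> grade C a = 1.
Proof. by move=> Ca; rewrite /grade mem_set. Qed.

Lemma grade_notin A (C : set A) (a : A) : ~ C a -> grade C a = 0.
Proof. by move=> Ca; rewrite /grade memNset. Qed.

Lemma path_grade_ge0 A (C : set A) (p : seq A) : 0 <= path_grade C p.
Proof. by apply: sumr_ge0 => a _; rewrite /grade; case: ifP. Qed.

Lemma compatible_cycle V A (Q : quiver V A) (C D : set A) (x : V) (p : seq A) :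
  compatible Q C D -> is_path Q x p x -> path_grade C p = path_grade D p.
Proof.
move=> CD pP; rewrite -!path_walk_grade.
by apply: (CD x); exact: is_path_walk.
Qed.

(** * The two hypotheses along a compatibility class *)

Lemma enough_compatiblesP V A (Q : quiver V A) (C D : set A) (a : A) :
  enough_compatibles Q C -> compatible Q D C ->
  exists2 C', compatible Q C' D & C' a.
Proof.
move=> enough DC.
have : [set: A] a by [].
rewrite enough => -[C' C'C C'a]; exists C' => // x p pP.
by rewrite (DC x p pP); apply: (C'C x).
Qed.

Lemma sufficiently_cyclic_compatible V (A : eqType) (Q : quiver V A)
    (C D : set A) :
  sufficiently_cyclic Q C -> compatible Q D C -> sufficiently_cyclic Q D.
Proof.
move=> cyc DC a; have [x [p [pP ap le1]]] := cyc a.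
by exists x, p; split=> //; rewrite (compatible_cycle DC pP).
Qed.

(** * The order given by paths of grade zero *)

Definition prec V A (Q : quiver V A) (D : set A) (x y : V) : Prop :=
  exists p, [/\ p <> [::], is_path Q x p y & path_grade D p = 0].

Lemma prec_trans V A (Q : quiver V A) (D : set A) (x y z : V) :
  prec Q D x y -> prec Q D y z -> prec Q D x z.
Proof.
move=> [p [p0 pP pg]] [q [q0 qP qg]]; exists (p ++ q); split.
- by case: p p0 {pP pg}.
- by apply/is_path_cat; exists y.
- by rewrite path_grade_cat pg qg.
Qed.

(** A cycle of grade 0 has grade 0 for every compatible set, but some
    compatible set contains its first arrow. *)
Lemma prec_irrefl V A (Q : quiver V A) (C D : set A) (x : V) :
  enough_compatibles Q C -> compatible Q D C -> ~ prec Q D x x.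
Proof.
move=> enough DC [[|b p] [] // _ pP pg].
have [C' C'D C'b] := enough_compatiblesP b enough DC.
have := compatible_cycle C'D pP.
rewrite pg path_grade_cons grade_in //.
by have := path_grade_ge0 C' p; lia.
Qed.

Lemma prec_notin V A (Q : quiver V A) (D : set A) (a : A) :
  ~ D a -> prec Q D (qsrc Q a) (qtgt Q a).
Proof.
move=> Da; exists [:: a]; split=> //.
by rewrite /path_grade big_seq1 grade_notin.
Qed.

(** Removing [a] from a cycle of grade at most 1 leaves a return path of grade
    0. This path is nonempty because [a] is not a loop. *)
Lemma prec_in V (A : eqType) (Q : quiver V A) (D : set A) (a : A) :
  no_loops Q -> sufficiently_cyclic Q D -> D a ->
  prec Q D (qtgt Q a) (qsrc Q a).
Proof.
move=> noloop cyc Da; have [x [p [pP ap le1]]] := cyc a.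
case/splitPr: ap pP le1 => p1 p2 /is_path_cat[y p1P /= [ay p2P]].
rewrite -{y}ay in p1P.
rewrite path_grade_cat path_grade_cons (grade_in Da) => le1.
exists (p2 ++ p1); split.
- case: p2 p2P {le1} => [|//] /= tx; case: p1 p1P => [|//] /= xs _.
  by apply: (noloop a); rewrite tx.
- by apply/is_path_cat; exists x.
- rewrite path_grade_cat.
  have := path_grade_ge0 D p1; have := path_grade_ge0 D p2; lia.
Qed.

(** By transitivity and irreflexivity, passing to a smaller element of [X]
    strictly decreases the number of predecessors in [X]. *)
Lemma exists_minimal (T : finType) (r : T -> T -> Prop) (X : pred T) (x0 : T) :
  (forall x y z, r x y -> r y z -> r x z) -> (forall x, ~ r x x) -> X x0 ->
  exists2 x, X x & forall y, X y -> ~ r y x.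
Proof.
move=> rtrans rirr Xx0.
case: (arg_minnP (fun x => #|[pred y | X y && `[< r y x >]]|) Xx0) => x Xx minx.
exists x => // y Xy ryx; have := minx y Xy; rewrite leqNgt => /negP; apply.
apply/proper_card/properP; split.
  apply/fintype.subsetP => z; rewrite !inE => /andP[-> /asboolP rzy] /=.
  by apply/asboolP; exact: rtrans ryx.
exists y; rewrite !inE ?Xy /=; first exact/asboolP.
by apply/asboolP.
Qed.

(** Used with [d] the difference of two heights whose cuts are [D] and [E]. The
    source is a vertex where [d] is maximal, minimal for [prec] among these: an
    arrow joining it to a vertex where [d] is smaller has grades in [D] and [E]
    that differ, which determines both, and an arrow joining it to another
    maximum in the wrong way would contradict minimality. *)
Lemma exists_strict_source (V : finType) (A : eqType) (Q : quiver V A)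
    (C D E : set A) (d : V -> int) (x0 : V) :
  no_loops Q -> enough_compatibles Q C -> sufficiently_cyclic Q C ->
  compatible Q D C ->
  (forall a, grade D a - grade E a = d (qtgt Q a) - d (qsrc Q a)) ->
  0 < d x0 -> exists2 x, 0 < d x & cut_strict_source Q D x.
Proof.
move=> noloop enough cyc DC dP x0P.
have cycD := sufficiently_cyclic_compatible cyc DC.
case: (@arg_maxP _ _ _ x0 xpredT d isT) => m _ maxm.
have [|x /eqP dx minx] := @exists_minimal _ (prec Q D) [pred x | d x == d m] m
  (@prec_trans _ _ Q D) (fun x => @prec_irrefl _ _ Q C D x enough DC) _.
  by rewrite /=.
have maxx y : d y <= d x by rewrite dx; exact: maxm.
exists x; first exact: lt_le_trans x0P (maxx _).
split=> a ax.
- apply: contrapT => Da; have := dP a.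
  have /eqP neq : d (qsrc Q a) <> d x.
    move=> sx; apply: (minx (qsrc Q a)); first by rewrite /= sx dx.
    by rewrite -ax; exact: prec_notin.
  have := maxx (qsrc Q a); rewrite ax grade_notin // /grade.
  by case: ifP => _; lia.
- move=> Da; have := dP a.
  have /eqP neq : d (qtgt Q a) <> d x.
    move=> tx; apply: (minx (qtgt Q a)); first by rewrite /= tx dx.
    by rewrite -ax; exact: prec_in.
  have := maxx (qtgt Q a); rewrite ax grade_in // /grade.
  by case: ifP => _; lia.
Qed.

(** * Heights and compatible sets *)

Definition slope V A (Q : quiver V A) (C : set A) (f : V -> int) (a : A) : int :=
  grade C a + f (qtgt Q a) - f (qsrc Q a).

Definition is_height V A (Q : quiver V A) (C : set A) (f : V -> int) : Prop :=
  forall a, 0 <= slope Q C f a <= 1.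

Definition height_cut V A (Q : quiver V A) (C : set A) (f : V -> int) : set A :=
  [set a | slope Q C f a = 1].

Lemma grade_height_cut V A (Q : quiver V A) (C : set A) (f : V -> int) (a : A) :
  is_height Q C f -> grade (height_cut Q C f) a = slope Q C f a.
Proof.
move=> /(_ a) /andP[h0 h1].
have [fa|fa] := eqVneq (slope Q C f a) 1; first by rewrite grade_in.
by rewrite grade_notin; [lia | apply/eqP].
Qed.

(** The increments of [f] telescope along a walk. *)
Lemma walk_grade_potential V A (Q : quiver V A) (C D : set A) (f : V -> int) :
  (forall a, grade D a = slope Q C f a) ->
  forall p x y, is_walk Q x p y -> walk_grade D p = walk_grade C p + f y - f x.
Proof.
move=> Df; elim=> [|w p IH] x y.
  by rewrite /is_walk /= => ->; rewrite /walk_grade !big_nil; lia.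
move=> [wx /IH pP]; rewrite !walk_grade_cons pP -wx.
by case: w {wx pP} => a /=; rewrite Df /slope; lia.
Qed.

Lemma compatible_height_cut V A (Q : quiver V A) (C : set A) (f : V -> int) :
  is_height Q C f -> compatible Q (height_cut Q C f) C.
Proof.
move=> hf x p /(walk_grade_potential (fun a => grade_height_cut a hf)) ->.
by lia.
Qed.

(** The potential at [x] is the difference of the grades of a walk from [x] to
    the chosen root of its connected component. Following an arrow, then the
    walk from its target to the root, then backwards the walk from its source,
    is a cyclic walk, on which compatibility gives the equation. *)
Lemma compatible_potential (V : choiceType) A (Q : quiver V A) (C D : set A) :
  compatible Q D C -> exists f, forall a, grade D a = slope Q C f a.
Proof.
move=> DC.
pose linked x : pred V := fun y => `[< exists p, is_walk Q x p y >].
have linkedxx x : linked x x by apply/asboolP; exists [::].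
pose root x := choose (linked x) x.
have rootP x : exists p, is_walk Q x p (root x).
  exact/asboolP/(chooseP (linkedxx x)).
have rootE a : root (qsrc Q a) = root (qtgt Q a).
  have aP : is_walk Q (qsrc Q a) [:: inl a] (qtgt Q a) by [].
  have eqL : linked (qsrc Q a) =1 linked (qtgt Q a).
    move=> y; apply/asbool_equiv_eq; split=> -[p pP].
      by eexists; apply: is_walk_cat pP; exact: is_walk_inv aP.
    by eexists; exact: is_walk_cat aP pP.
  (* The choice operator depends on its base point only through the predicate,
     so equal components get equal roots. *)
  rewrite /root (eq_choose eqL); apply: choose_id => //.
  by rewrite -eqL.
have [w wP] := choice rootP.
exists (fun x => walk_grade C (w x) - walk_grade D (w x)) => a.
have cyc : is_walk Q (qsrc Q a)
    (inl a :: (w (qtgt Q a) ++ rev (map (@flip A) (w (qsrc Q a))))) (qsrc Q a).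
  split=> //; apply: is_walk_cat (wP _) _.
  by rewrite -rootE; exact: is_walk_inv.
have := DC _ _ cyc.
by rewrite !walk_grade_cons !walk_grade_cat !walk_grade_inv /slope; lia.
Qed.

Lemma compatible_is_height_cut (V : choiceType) A (Q : quiver V A)
    (C D : set A) :
  compatible Q D C -> exists2 f, is_height Q C f & D = height_cut Q C f.
Proof.
move=> /compatible_potential[f fP]; exists f.
  by move=> a; rewrite -fP /grade; case: ifP.
apply/seteqP; split=> a.
  by move=> Da; rewrite /height_cut /= -fP grade_in.
rewrite /height_cut /= -fP => Da; apply: contrapT => /(@grade_notin _ _ _).
by rewrite Da.
Qed.

(** * Lowering a height at a strict source *)

Definition lower (V : eqType) (x : V) (f : V -> int) (y : V) : int :=
  if y == x then f y - 1 else f y.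

Lemma slope_lower (V : eqType) A (Q : quiver V A) (C : set A) (f : V -> int)
    (x : V) (a : A) :
  slope Q C (lower x f) a =
  slope Q C f a - (if qtgt Q a == x then 1 else 0)
                + (if qsrc Q a == x then 1 else 0).
Proof. by rewrite /slope /lower; case: ifP; case: ifP; lia. Qed.

Lemma height_notin V A (Q : quiver V A) (C : set A) (f : V -> int) (a : A) :
  is_height Q C f -> (~ height_cut Q C f a) <-> slope Q C f a = 0.
Proof.
by move=> /(_ a) /andP[h0 h1]; rewrite /height_cut /=; split=> ?; lia.
Qed.

(** The three kinds of arrows around a strict source; without loops they
    exclude each other. *)
Lemma height_source (V : eqType) A (Q : quiver V A) (C : set A) (f : V -> int)
    (x : V) (a : A) :
  no_loops Q -> is_height Q C f -> cut_strict_source Q (height_cut Q C f) x ->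
  [\/ [/\ qtgt Q a = x, qsrc Q a <> x, slope Q C f a = 1 &
          slope Q C (lower x f) a = 0],
      [/\ qsrc Q a = x, qtgt Q a <> x, slope Q C f a = 0 &
          slope Q C (lower x f) a = 1] |
      [/\ qsrc Q a <> x, qtgt Q a <> x &
          slope Q C (lower x f) a = slope Q C f a]].
Proof.
move=> noloop hf [inx outx].
have [tx|tx] := eqVneq (qtgt Q a) x.
  apply: Or31; have sx : qsrc Q a <> x by rewrite -tx; exact: noloop.
  have fa : slope Q C f a = 1 := inx _ tx.
  by rewrite slope_lower fa tx eqxx; move/eqP/negPf: (sx) => ->.
have [sx|sx] := eqVneq (qsrc Q a) x.
  apply: Or32; have /(height_notin a hf) fa := outx _ sx.
  rewrite slope_lower fa sx eqxx (negPf tx).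
  by split=> //; exact/eqP.
apply: Or33; split; try exact/eqP.
by rewrite slope_lower (negPf sx) (negPf tx); lia.
Qed.

Lemma height_lower (V : eqType) A (Q : quiver V A) (C : set A) (f : V -> int)
    (x : V) :
  no_loops Q -> is_height Q C f -> cut_strict_source Q (height_cut Q C f) x ->
  is_height Q C (lower x f).
Proof.
move=> noloop hf srcx a.
by have [[_ _ _ ->]|[_ _ _ ->]|[_ _ ->]] := height_source a noloop hf srcx.
Qed.

(** The slope conditions only bound differences of values of a height from both
    sides, and such bounds pass to a minimum. *)
Lemma height_min V A (Q : quiver V A) (C : set A) (f g : V -> int) :
  is_height Q C f -> is_height Q C g ->
  is_height Q C (fun x => Num.min (f x) (g x)).
Proof.
by move=> hf hg a; move: (hf a) (hg a); rewrite /slope; lia.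
Qed.

(** The interpretation [F] and the relation [R] are left abstract so that the
    same descent serves the cuts and the slices. Sink mutations enter only as
    the inverses of lowerings, hence both directions in the hypothesis on [R].
    *)
Lemma heights_connected (V : finType) (A : eqType) (Q : quiver V A) (C : set A)
    (T : Type) (R : T -> T -> Prop) (F : (V -> int) -> T) (f g : V -> int) :
  no_loops Q -> enough_compatibles Q C -> sufficiently_cyclic Q C ->
  (forall f x, is_height Q C f -> cut_strict_source Q (height_cut Q C f) x ->
     R (F f) (F (lower x f)) /\ R (F (lower x f)) (F f)) ->
  is_height Q C f -> is_height Q C g -> clos_refl_trans T R (F f) (F g).
Proof.
move=> noloop enough cyc RF.
have down n h k : is_height Q C h -> is_height Q C k ->
    (forall x, k x <= h x) -> \sum_x (h x - k x) <= n%:Z ->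
    clos_refl_trans T R (F h) (F k) /\ clos_refl_trans T R (F k) (F h).
  (* Each lowering at a vertex where h > k decreases the sum by 1. *)
  elim: n h => [|n IH] h hh hk kh le_n;
    have [/existsP[x0 x0P]|/existsPn nx] := boolP [exists x, 0 < h x - k x];
    try (have -> : h = k by apply/funext => x; have := nx x; have := kh x; lia);
    try by split; exact: rt_refl.
  - have : 0 < \sum_x (h x - k x).
      rewrite (bigD1 x0) //= ltr_pwDl // sumr_ge0 // => x _.
      by have := kh x; lia.
    by lia.
  - have [|||x xP srcx] := @exists_strict_source V A Q C (height_cut Q C h)
      (height_cut Q C k) (fun x => h x - k x) x0 noloop enough cyc.
    + exact: compatible_height_cut.
    + by move=> a; rewrite !grade_height_cut // /slope; lia.
    + by [].
    have [down_x up_x] := RF _ _ hh srcx.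
    have [|| down_k up_k] := IH (lower x h) (height_lower noloop hh srcx) hk.
    + by move=> y; rewrite /lower; case: eqP => [->|_] //; lia.
    + have -> : \sum_y (lower x h y - k y) = \sum_y (h y - k y) - 1.
        rewrite -[X in _ - X](@big_pred1_eq _ 0 +%R _ x (fun=> 1)).
        rewrite [X in _ - X]big_mkcond -sumrB; apply: eq_bigr => y _ /=.
        by rewrite /lower; case: ifP; lia.
      by lia.
    by split; [apply: rt_trans down_k; exact: rt_step |
               apply: rt_trans up_k _; exact: rt_step].
move=> hf hg.
pose m : V -> int := fun x => Num.min (f x) (g x).
have hm : is_height Q C m := height_min hf hg.
have bound (h : V -> int) :
  \sum_x (h x - m x) <= (absz (\sum_x (h x - m x)))%:Z by rewrite abszE ler_norm.
have [|fm _] := down _ f m hf hm _ (bound f); first by move=> x; rewrite /m; lia.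
have [|_ mg] := down _ g m hg hm _ (bound g); first by move=> x; rewrite /m; lia.
exact: rt_trans fm mg.
Qed.

(** * Lowerings as cut-mutations and as slice-mutations *)

Lemma cut_mutation_lower (V : eqType) A (Q : quiver V A) (C : set A)
    (f : V -> int) (x : V) :
  no_loops Q -> is_height Q C f -> cut_strict_source Q (height_cut Q C f) x ->
  cut_mutation Q (height_cut Q C f) (height_cut Q C (lower x f)) /\
  cut_mutation Q (height_cut Q C (lower x f)) (height_cut Q C f).
Proof.
move=> noloop hf srcx; split; exists x; [left|right]; split=> //.
- apply/seteqP; split=> a; rewrite /cut_mu_plus /height_cut /=;
    have [[ax bx -> ->]|[ax bx -> ->]|[ax bx ->]] := height_source a noloop hf srcx;
    by intuition lia.
- split=> a ax; rewrite /height_cut /=;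
    have [[bx cx e ->]|[bx cx e ->]|[bx cx ->]] := height_source a noloop hf srcx => //.
- apply/seteqP; split=> a; rewrite /cut_mu_minus /height_cut /=;
    have [[ax bx -> ->]|[ax bx -> ->]|[ax bx ->]] := height_source a noloop hf srcx;
    by intuition lia.
Qed.

Definition graph V (f : V -> int) : set (V * int) := [set v | v.2 = f v.1].

Lemma Zquiver_tgt V A (Q : quiver V A) (C : set A) (a : A) (l : int) :
  qtgt (Zquiver Q C) (a, l) = (qtgt Q a, l - grade C a).
Proof. by rewrite /= /grade; case: ifP; rewrite ?subr0. Qed.

(** The arrow of the covering quiver over [a] which starts on the graph ends on
    the graph if the slope of [a] is 0, and on its translate by the inverse of
    [tau] if the slope is 1. *)
Lemma is_slice_graph V A (Q : quiver V A) (C : set A) (f : V -> int) :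
  is_slice Q C (graph f) <-> is_height Q C f.
Proof.
split=> [[_ slf] a|hf].
  have := slf (a, f (qsrc Q a)) (erefl _).
  rewrite Zquiver_tgt /graph /slope => -[/= e|[[y l] /= -> [-> e]]]; lia.
split=> [v|[a l] sa].
  exists (v.1, f v.1); split; first split=> //.
    by exists (f v.1 - v.2); rewrite /tau_pow; congr (_, _); lia.
  by move=> [y l] [[k [-> _]]]; rewrite /graph /= => ->.
rewrite Zquiver_tgt.
have := hf a; rewrite /graph /= in sa *; rewrite /slope -sa => ha.
have [e|e] := eqVneq (f (qtgt Q a)) (l - grade C a); first by left.
right; exists (qtgt Q a, f (qtgt Q a)) => //=.
by rewrite /tau_pow /=; congr (_, _); lia.
Qed.

Lemma slice_is_graph V A (Q : quiver V A) (C : set A) (S : set (V * int)) :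
  is_slice Q C S -> exists f, S = graph f.
Proof.
move=> [uniqS _].
have fP x : exists k : int, forall l : int, S (x, l) <-> l = k.
  have [[y k] [[[j [-> _]] Sxk] uk]] := uniqS (x, 0); exists k => l; split.
    move=> Sxl; suff [] : (x, k) = (x, l) by [].
    apply: uk; split=> //; exists l; rewrite /tau_pow /=; congr (_, _); lia.
  by move=> ->.
have [f {}fP] := choice fP.
by exists f; apply/seteqP; split=> -[x l] /fP.
Qed.

Lemma full_arrows_graph V A (Q : quiver V A) (C : set A) (f : V -> int)
    (a : A) (l : int) :
  full_arrows (Zquiver Q C) (graph f) (a, l) <->
  l = f (qsrc Q a) /\ slope Q C f a = 0.
Proof.
by rewrite /full_arrows /mkset Zquiver_tgt /graph /slope /=; split=> -[]; lia.
Qed.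

(** An arrow with one end on the graph of a height belongs to the slice exactly
    when its slope is 0, so strict sources and sinks of the slice are those of
    the cut. *)
Lemma slice_mutation_lower (V : eqType) A (Q : quiver V A) (C : set A)
    (f : V -> int) (x : V) :
  no_loops Q -> is_height Q C f -> cut_strict_source Q (height_cut Q C f) x ->
  slice_mutation Q C (graph f) (graph (lower x f)) /\
  slice_mutation Q C (graph (lower x f)) (graph f).
Proof.
move=> noloop hf srcx.
have lx : lower x f x = f x - 1 by rewrite /lower eqxx.
split; [exists (x, f x); left | exists (x, f x - 1); right]; split.
- split=> // -[a l]; rewrite ?Zquiver_tgt full_arrows_graph => -[ax al];
    have [[bx cx e e']|[bx cx e e']|[bx cx e]] := height_source a noloop hf srcx => //.
  + by rewrite e => -[].
  + by rewrite ax.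
- apply/seteqP; split=> -[y l]; rewrite /graph /slice_mu_plus /tau_pow /lower /=.
  + case: eqP => [->|nyx] ->; first by right.
    by left; split=> // -[].
  + case=> [[-> ne]|[-> ->]]; last by rewrite eqxx.
    by case: eqP => // yx; case: ne; rewrite yx.
- split=> [|[a l]|[a l]]; first by rewrite /graph /= lx.
  + rewrite Zquiver_tgt full_arrows_graph => -[ax al].
    have [[bx cx e e']|[bx cx e e']|[bx cx e]] := height_source a noloop hf srcx => //.
    by move: e'; rewrite /slope ax lx; lia.
  + rewrite full_arrows_graph => -[ax al].
    have [[bx cx e e']|[bx cx e e']|[bx cx e]] := height_source a noloop hf srcx => //.
    by rewrite e' => -[].
- apply/seteqP; split=> -[y l]; rewrite /graph /slice_mu_minus /tau_pow /lower /=.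
  + move=> ->; case: (eqVneq y x) => [->|nyx]; first by right; congr (_, _); lia.
    by left; split=> // -[yx]; rewrite yx eqxx in nyx.
  + case=> [[+ ne]|[-> ->]]; last by lia.
    by case: (eqVneq y x) => // yx e; case: ne; rewrite e yx.
Qed.

Theorem theorem6p18 (Q0 Q1 : finType) (Q : quiver Q0 Q1) (C : set Q1)
    (hloop : no_loops Q)
    (henough : enough_compatibles Q C)
    (hcyc : sufficiently_cyclic Q C) :
  transitive_under [set C' : set Q1 | compatible Q C' C] (cut_mutation Q) /\
  transitive_under [set S : set (Q0 * int) | is_slice Q C S]
    (slice_mutation Q C).
Proof.
split.
- move=> C1 C2 /compatible_is_height_cut[f hf ->].
  move=> /compatible_is_height_cut[g hg ->].
  apply: (heights_connected hloop henough hcyc) => // h x hh srcx.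
  have [down up] := cut_mutation_lower hloop hh srcx.
  have lh := height_lower hloop hh srcx.
  by split; split=> //; exact: compatible_height_cut.
- move=> S1 S2 /[dup] /slice_is_graph[f ->] /is_slice_graph hf.
  move=> /[dup] /slice_is_graph[g ->] /is_slice_graph hg.
  apply: (heights_connected hloop henough hcyc) => // h x hh srcx.
  have [down up] := slice_mutation_lower hloop hh srcx.
  have lh := height_lower hloop hh srcx.
  by split; split=> //; exact/is_slice_graph.
Qed.
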